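(* Let $X$ be a space and consider the following conditions: (1) $X$ is $\mu^{\#}_b$-complete, that is, every subset of $C_p(X)$ that is bounded in $C_p(X)$ has compact closure in $C_p(X)$; (2) $X$ is a $w_s$-$q_f$-space; (3) $X$ is a $W_1$-$q_f$-space; (4) $X$ is a nearly $q_D$-space; (5) $X$ is a product of Čech-complete spaces. Then $(5)\Rightarrow(4)\Rightarrow(3)\Rightarrow(2)\Rightarrow(1)$. In particular, a product of Čech-complete spaces is $\mu^{\#}_b$-complete.
   Context: All spaces are Tychonoff. $C_p(X)$ is the space of continuous real-valued functions on $X$ with the topology of pointwise convergence. A subset $Y$ of a space $T$ is bounded in $T$ if every continuous function $T\to\mathbb R$ is bounded on $Y$. All games are played by two players $\alpha$ and $\beta$ for countably many steps $n=0,1,2,\dots$; strategies may depend on all previous moves. A game is $\theta$-favorable if player $\theta$ has a winning strategy, and $\theta$-unfavorable otherwise. Subsets $A,B$ of $X$ are functionally separated if there is a continuous $g:X\to[0,1]$ with $g(A)\subset\{0\}$ and $g(B)\subset\{1\}$. Nearly $q_D$-spaces: let $D$ be dense in $X$ and $x_*\in X$. Put $U_{-1}=X$. At step $n$, player $\beta$ chooses $x_n\in U_{n-1}\cap D$, then player $\alpha$ chooses a neighborhood $U_n$ of $x_*$. Player $\alpha$ wins if $(x_n)_{n\in\omega}$ has an accumulation point in $X$. The point $x_*$ is a nearly $q_D$-point relative to $D$ if this game is $\alpha$-favorable. $X$ is a nearly $q_D$-space if there is a dense $D\subset X$ such that every $x\in X$ is a nearly $q_D$-point relative to $D$. The game $\Gamma(AV(X,x,A,\lambda),I_f)$: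 let $A\subset X$, $x\in\overline A\setminus A$, and let $\lambda$ be a cover of $X$. At step $n$, player $\beta$ chooses a neighborhood $V_n$ of $x$, then player $\alpha$ chooses $S_n\subset A$ such that $S_n\subset L$ for some $L\in\lambda$. Player $\alpha$ wins if there exists $S\subset\bigcap_n V_n$ such that $S\subset L$ for some $L\in\lambda$ and the sets $S$ and $\bigcup_n S_n$ are not functionally separated. $X$ is a $W$-$q_f$-space (respectively, $w$-$q_f$-space) with respect to $\lambda$ if for every discontinuous function $f:X\to\mathbb R$ there are a non-closed $A\subset X$ and a point $x\in\overline A\setminus A$ such that $f(x)\notin\overline{f(A)}$ and the game $\Gamma(AV(X,x,A,\lambda),I_f)$ is $\alpha$-favorable (respectively, $\beta$-unfavorable). $X$ is a $w_s$-$q_f$-space if it is a $w$-$q_f$-space with respect to the family $\mathcal P_s(X)$ of all separable subspaces of $X$; $X$ is a $W_1$-$q_f$-space if it is a $W$-$q_f$-space with respect to $\mathcal P_1(X)=\{\{x\}:x\in X\}$. *)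

(* Defs.v *)
From HB Require Import structures.
From mathcomp Require Import all_boot all_order all_algebra.
From mathcomp Require Import all_classical all_reals all_analysis.
From mathcomp Require Import borel_hierarchy.
Set Implicit Arguments.
Unset Strict Implicit.
Unset Printing Implicit Defensive.
Import Order.TTheory GRing.Theory Num.Theory.
Import numFieldNormedType.Exports.
Local Open Scope classical_set_scope.
Local Open Scope ring_scope.

Definition tychonoff_space (X : topologicalType) : Prop :=
  accessible_space X /\ completely_regular_space X.

Definition homeomorphic (X Y : topologicalType) : Prop :=
  exists (f : X -> Y) (g : Y -> X),
    [/\ cancel f g, cancel g f, continuous f & continuous g].

Definition embedding (X Y : topologicalType) (e : X -> Y) : Prop :=
  [/\ injective e, continuous e &
      forall U : set X, open U -> exists2 V : set Y, open V & e @^-1` V = U].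

(* G_delta in some Hausdorff compactification; by a classical theorem this does
   not depend on the compactification chosen. *)
Definition cech_complete (X : topologicalType) : Prop :=
  tychonoff_space X /\
  exists (K : topologicalType) (e : X -> K),
    [/\ hausdorff_space K, compact [set: K], embedding e,
        dense (range e) & Gdelta (range e)].

Definition product_of_cech_complete (X : topologicalType) : Prop :=
  exists (I : Type) (T : I -> topologicalType),
    (forall i, cech_complete (T i)) /\ homeomorphic X (prod_topology T).

Definition Cp (R : realType) (X : topologicalType) : topologicalType :=
  initial_topology (fun f : continuousType X R => (f : {ptws X -> R})).

Definition bounded_in (R : realType) (T : topologicalType) (Y : set T) : Prop :=
  forall f : T -> R, continuous f -> bounded_set (f @` Y).

Definition mu_sharp_b_complete (R : realType) (X : topologicalType) : Prop :=
  forall Y : set (Cp R X), bounded_in R Y -> compact (closure Y).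

(* At step n, beta moves first, subject to a rule that may refer to alpha's
   moves 0, ..., n-1; then alpha moves, subject to a rule that may refer to
   beta's moves 0, ..., n.  [game_alpha_wins] is evaluated on the completed
   sequences of moves of beta and of alpha. *)
Record game := Game {
  game_beta_move : Type;
  game_alpha_move : Type;
  game_beta_legal : seq game_alpha_move -> game_beta_move -> Prop;
  game_alpha_legal : seq game_beta_move -> game_alpha_move -> Prop;
  game_alpha_wins :
    (nat -> game_beta_move) -> (nat -> game_alpha_move) -> Prop }.

(* A strategy is a function of the opponent's previous moves, since these
   determine the player's own previous moves.  A winning strategy has to
   produce legal moves as long as the opponent's moves are legal, and to win
   every run in which all of the opponent's moves are legal. *)
Definition alpha_favorable (G : game) : Prop :=
  exists sigma : seq (game_beta_move G) -> game_alpha_move G,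
  forall b : nat -> game_beta_move G,
    let a := fun n => sigma (mkseq b n.+1) in
    (forall n, (forall k, (k <= n)%N -> game_beta_legal (mkseq a k) (b k)) ->
       game_alpha_legal (mkseq b n.+1) (a n)) /\
    ((forall n, game_beta_legal (mkseq a n) (b n)) -> game_alpha_wins b a).

Definition beta_favorable (G : game) : Prop :=
  exists tau : seq (game_alpha_move G) -> game_beta_move G,
  forall a : nat -> game_alpha_move G,
    let b := fun n => tau (mkseq a n) in
    (forall n, (forall k, (k < n)%N -> game_alpha_legal (mkseq b k.+1) (a k)) ->
       game_beta_legal (mkseq a n) (b n)) /\
    ((forall n, game_alpha_legal (mkseq b n.+1) (a n)) ->
       ~ game_alpha_wins b a).

(* [last setT Us] is U_(n-1), with U_(-1) the whole space. *)
Definition nearly_q_game (X : topologicalType) (D : set X) (x : X) : game :=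
  @Game X (set X)
    (fun (Us : seq (set X)) (y : X) => (last [set: X] Us `&` D) y)
    (fun (_ : seq X) (U : set X) => nbhs x U)
    (fun (u : nat -> X) (_ : nat -> set X) => cluster (u @ \oo) !=set0).

Definition nearly_q_point (X : topologicalType) (D : set X) (x : X) : Prop :=
  alpha_favorable (nearly_q_game D x).

Definition nearly_qD_space (X : topologicalType) : Prop :=
  exists2 D : set X, dense D & forall x : X, nearly_q_point D x.

Definition functionally_separated (R : realType) (X : topologicalType)
    (A B : set X) : Prop :=
  exists g : X -> R, [/\ continuous g, range g `<=` `[0, 1]%classic,
    g @` A `<=` [set 0] & g @` B `<=` [set 1]].

Definition AV_game (R : realType) (X : topologicalType) (x : X) (A : set X)
    (lambda : set (set X)) : game :=
  @Game (set X) (set X)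
    (fun (_ : seq (set X)) (V : set X) => nbhs x V)
    (fun (_ : seq (set X)) (S : set X) =>
       S `<=` A /\ exists2 L, lambda L & S `<=` L)
    (fun V S : nat -> set X =>
       exists S' : set X, [/\ S' `<=` \bigcap_n V n,
         exists2 L, lambda L & S' `<=` L &
         ~ functionally_separated R S' (\bigcup_n S n)]).

Definition W_qf_space (R : realType) (X : topologicalType)
    (lambda : set (set X)) : Prop :=
  forall f : X -> R, ~ continuous f ->
  exists (A : set X) (x : X),
    [/\ ~ closed A, (closure A `\` A) x, ~ closure (f @` A) (f x) &
        alpha_favorable (AV_game R x A lambda)].

Definition w_qf_space (R : realType) (X : topologicalType)
    (lambda : set (set X)) : Prop :=
  forall f : X -> R, ~ continuous f ->
  exists (A : set X) (x : X),
    [/\ ~ closed A, (closure A `\` A) x, ~ closure (f @` A) (f x) &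
        ~ beta_favorable (AV_game R x A lambda)].

Definition separable_set (X : topologicalType) (A : set X) : Prop :=
  exists C : set X, [/\ countable C, C `<=` A & A `<=` closure C].

Definition ws_qf_space (R : realType) (X : topologicalType) : Prop :=
  w_qf_space R [set A : set X | separable_set A].

Definition W1_qf_space (R : realType) (X : topologicalType) : Prop :=
  W_qf_space R (@singletons X).

(* Main.v *)
(** (5) => (4): take for [D] the points of finite support relative to a base
    point.  Against them [alpha] shrinks, in the finitely many coordinates used
    so far, to neighborhoods whose closures in the compactifications lie in the
    first open sets of the G_delta representations; then every ultrafilter on
    the run converges in each coordinate.

    (4) => (3): a discontinuous [f] is discontinuous at some [x] along [D], and
    [A] is the set of points of [D] with values far from [f x].  In the
    [AV]-game [alpha] simulates the nearly-q game with points of [A] taken in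
    closed neighborhoods, and a cluster point of them is the required [S].

    (3) => (2): the two players cannot both have a winning strategy.

    (2) => (1): if [Y] is bounded in [C_p(X)] and [h] is a pointwise limit of
    [Y], then [h] agrees on every separable set with a continuous function, for
    otherwise the inverse of a distance to [h] would be an unbounded continuous
    function on [Y].  If some pointwise limit [f] were discontinuous, [beta]
    would defeat [alpha] by playing the sets where functions [u n] of [Y], which
    approximate [f] on points dense in the previous moves, are nearly equal to
    their value at [x]: a limit [h] of the [u n] equals [f x] on [S], and its
    continuous extension equals [f] on the moves of [alpha]. *)

From HB Require Import structures.
Require Import Defs.
From mathcomp Require Import all_boot all_order all_algebra.
From mathcomp Require Import all_classical all_reals all_analysis.
From mathcomp Require Import ring lra.
Set Implicit Arguments.
Unset Strict Implicit.
Unset Printing Implicit Defensive.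
Import Order.TTheory GRing.Theory Num.Theory.
Import numFieldNormedType.Exports.
Local Open Scope classical_set_scope.
Local Open Scope ring_scope.

(** * Games *)

(** The two strategies are played against each other: [st n] holds the first [n] moves of both
    players. Each strategy promises legal moves only against legal ones, so legality of both sides
    is proved in one strong induction. *)
Lemma alpha_favorable_not_beta (G : game) :
  alpha_favorable G -> ~ beta_favorable G.
Proof.
move=> [sg sgP] [ta taP].
pose st := fix st n := if n is m.+1
  then let b := rcons (st m).1 (ta (st m).2) in (b, rcons (st m).2 (sg b))
  else ([::], [::]).
pose b n := ta (st n).2; pose a n := sg (st n.+1).1.
have sb n : (st n).1 = mkseq b n by elim: n => // n IH; rewrite mkseqS -IH.
have sa n : (st n).2 = mkseq a n by elim: n => // n IH; rewrite mkseqS -IH.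
have bE : (fun n => ta (mkseq a n)) = b by apply: funext => n; rewrite -sa.
have aE : (fun n => sg (mkseq b n.+1)) = a by apply: funext => n; rewrite -sb.
have [/= al aw] := sgP b; have [/= bl bw] := taP a.
rewrite bE in bl bw; rewrite aE in al aw.
have legal n : game_beta_legal (mkseq a n) (b n) /\
    game_alpha_legal (mkseq b n.+1) (a n).
  elim/ltn_ind: n => n IH.
  have bn : game_beta_legal (mkseq a n) (b n).
    by rewrite /b sa; apply: bl => k /IH[].
  split=> //; rewrite /a sb; apply: al => k.
  by rewrite leq_eqVlt => /predU1P[-> //|/IH[]].
by apply: bw => [n|]; [|apply: aw => n]; have [] := legal n.
Qed.

Lemma alpha_favorable_AV_sub (R : realType) (X : topologicalType) (x : X)
    (A : set X) (l1 l2 : set (set X)) : l1 `<=` l2 ->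
  alpha_favorable (AV_game R x A l1) -> alpha_favorable (AV_game R x A l2).
Proof.
move=> l12 [sg sgP]; exists sg => b; have [/= al aw] := sgP b; split=> /=.
  by move=> n /al [SA [L /l12 lL SL]]; split=> //; exists L.
move=> /aw [S [SV [L /l12 lL SL] nsep]]; exists S; split=> //.
by exists L.
Qed.

Lemma W1_ws_qf_space (R : realType) (X : topologicalType) :
  W1_qf_space R X -> ws_qf_space R X.
Proof.
move=> W1 f /W1 [A [x [nclA clAx fx fav]]]; exists A, x; split=> //.
apply: alpha_favorable_not_beta; apply: alpha_favorable_AV_sub fav.
move=> _ [z _ <-]; exists [set z]; split=> //.
exact: subset_closure.
Qed.

(** * Nearly q-spaces *)

(** If the values on [D] near every point were close to the value at that point, then [f x] and
    [f y] for [y] near [x] could be compared through a point of [D] common to suitable neighborhoods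
    of both. *)
Lemma discontinuous_relative_to_dense (R : realType) (X : topologicalType)
    (D : set X) (f : X -> R) : dense D -> ~ continuous f ->
  exists x : X, exists2 e : R, 0 < e &
    closure [set d | D d /\ e <= `|f d - f x|] x.
Proof.
move=> dD; apply: contra_notP => H.
have small x (e : R) : 0 < e ->
    exists O, open_nbhs x O /\ forall d, O d -> D d -> `|f d - f x| < e.
  move=> e0; have : ~ closure [set d | D d /\ e <= `|f d - f x|] x.
    by move=> ?; apply: H; exists x, e.
  rewrite /closure /= => /existsNP [B] /not_implyP [nB nE].
  move: nB; rewrite nbhsE => -[C oC CB]; exists C; split=> // d Cd Dd.
  by rewrite ltNge; apply/negP => ?; apply: nE; exists d; split=> //; exact: CB.
move=> x; apply/cvgrPdist_lt => e e0.
have e20 : 0 < e / 2 by rewrite divr_gt0.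
have [Q [[oQ Qx] QD]] := small x _ e20.
apply: filterS (open_nbhs_nbhs (conj oQ Qx)) => y Qy /=.
have [P [[oP Py] PD]] := small y _ e20.
have [|d [[Qd Pd] Dd]] := dD (Q `&` P) _ (openI oQ oP); first by exists y.
have := QD _ Qd Dd; have := PD _ Pd Dd.
by rewrite !ltr_norml => /andP[? ?] /andP[? ?]; apply/andP; split; lra.
Qed.

Lemma nearly_qD_W1_qf_space (R : realType) (X : topologicalType) :
  completely_regular_space X -> nearly_qD_space X -> W1_qf_space R X.
Proof.
move=> crX [D dD qD] f ncf.
have [x [e e0 clAx]] := discontinuous_relative_to_dense dD ncf.
pose A := [set d | D d /\ e <= `|f d - f x|].
exists A, x.
have nAx : ~ A x by move=> [_]; rewrite subrr normr0 leNgt e0.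
split=> //; first by move=> /closure_id AE; apply: nAx; rewrite AE.
  move=> /(_ _ (nbhsx_ballx _ _ e0)) [_ [[a [_ ea] <-]]].
  by rewrite /ball /= distrC ltNge ea.
have [sg sgP] := qD x.
(* Closed neighborhoods keep the cluster points of the run inside the moves of beta. *)
have /choice[cn cnP] (V : set X) : exists C : set X,
    nbhs x V -> [/\ nbhs x C, closed C & C `<=` V].
  have [xV|] := pselect (nbhs x V); last by move=> ?; exists set0.
  have [C xC CV] := @completely_regular_regular R X crX x V xV.
  exists (closure C) => _; split=> //; last exact: closed_closure.
  exact: filterS (@subset_closure _ C) xC.
pose Uof (us : seq X) := if us is [::] then [set: X] else sg us.
pose step (s : seq X * set X) (V : set X) :=
  let W := s.2 `&` cn V in
  (rcons s.1 (xget x (A `&` Uof s.1 `&` W)), W).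
pose state Vs := foldl step ([::], [set: X]) Vs.
exists (fun Vs => [set last x (state Vs).1]) => b /=.
pose u n := last x (state (mkseq b n.+1)).1.
have stateS n : state (mkseq b n.+1) = step (state (mkseq b n)) (b n).
  by rewrite mkseqS /state -cats1 foldl_cat.
have uE n : (state (mkseq b n)).1 = mkseq u n.
  elim: n => // n IH; by rewrite [RHS]mkseqS -IH /u stateS /= last_rcons.
have Wn n : (forall k, (k < n)%N -> nbhs x (b k)) ->
    nbhs x (state (mkseq b n)).2.
  elim: n => [_|n IH bn]; first exact: filterT.
  rewrite stateS /=; apply: filterI; first by apply: IH => k /ltnW /bn.
  by have [] := cnP _ (bn n (ltnSn n)).
have Wcn n k : (k <= n)%N -> (state (mkseq b n.+1)).2 `<=` cn (b k).
  elim: n => [|n IH]; rewrite stateS; first by rewrite leqn0 => /eqP -> z [].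
  by rewrite leq_eqVlt => /predU1P[-> z []//|/IH] kW z [/kW].
have UofE n : Uof (mkseq u n) =
    last [set: X] (mkseq (fun m => sg (mkseq u m.+1)) n).
  by case: n => // n; rewrite [in RHS]mkseqS last_rcons.
have [/= ql qw] := sgP u.
have uP n : (forall k, (k <= n)%N -> nbhs x (b k)) ->
    (A `&` Uof (mkseq u n) `&` (state (mkseq b n.+1)).2) (u n).
  elim/ltn_ind: n => n IH bn.
  have -> : u n =
      xget x (A `&` Uof (mkseq u n) `&` (state (mkseq b n.+1)).2).
    by rewrite /u stateS /= last_rcons uE.
  apply: (@xgetPex _ x (A `&` Uof (mkseq u n) `&` (state (mkseq b n.+1)).2)).
  (* Legality of the earlier points makes [Uof] a neighborhood of [x]; it meets [A] because [x] lies
     in the closure of [A]. *)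
  have xU : nbhs x (Uof (mkseq u n)).
    case: n IH bn => [|n] IH bn; first exact: filterT.
    apply: ql => k kn; rewrite /= -UofE; split.
      have [] := IH k _ _; [exact: kn | | by case].
      by move=> j jk; apply: bn; rewrite (leq_trans jk)// (leq_trans kn).
    have [] := IH k _ _; [exact: kn | | by case; case].
    by move=> j jk; apply: bn; rewrite (leq_trans jk)// (leq_trans kn).
  have [z [Az [Uz Wz]]] := clAx _ (filterI xU (Wn n.+1 bn)).
  by exists z.
split.
  move=> n bn; rewrite -/(u n); split.
    by move=> _ ->; have [[]] := uP n bn.
  by exists [set u n] => //; exists (u n).
move=> bn; have {}bn n k : (k <= n)%N -> nbhs x (b k) by [].
have [|y cly] := qw.
  by move=> n; rewrite /= -UofE; have [[[]]] := uP n (bn n).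
exists [set y]; split.
- move=> _ -> k _; have [_ clC CV] := cnP _ (bn k k (leqnn k)).
  apply: CV; apply: clC => B yB.
  have [|_ [[n /= kn <-] Bu]] := cly (u @` [set n | (k <= n)%N]) B _ yB.
    by exists k => // n /= kn; exists n.
  exists (u n); split=> //; have [_] := uP n (bn n).
  exact: Wcn.
- by exists [set y] => //; exists y.
move=> [g [cg _ g0 g1]].
have gy : g y = 0 by apply: g0; exists y.
have gu n : g (u n) = 1.
  by apply: g1; exists (u n) => //; exists n.
have yB : nbhs y (g @^-1` ball (g y) 1).
  by apply: cg; exact: nbhsx_ballx.
have [|_ [[n _ <-]]] := cly (range u) _ _ yB.
  by exists 0%N => // n _; exists n.
by rewrite /= gu gy /ball /= sub0r normrN normr1 ltxx.
Qed.

(** * Products of Cech-complete spaces *)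

Lemma filter_forall_seq (T : Type) (F : set_system T) (I : eqType)
    (P : I -> set T) (s : seq I) : Filter F ->
  (forall i, i \in s -> F (P i)) -> F [set t | forall i, i \in s -> P i t].
Proof.
move=> FF; elim: s => [_|i s IH sP]; first exact: filterS filterT.
have Fi : F (P i) by apply: sP; rewrite inE eqxx.
have {IH sP}Fs := IH (fun j js => sP j (mem_behead (s := i :: s) js)).
apply: filterS (filterI Fi Fs) => t [it st] j.
by rewrite inE => /predU1P[->|/st].
Qed.

Lemma ultra_fmap (T U : Type) (f : T -> U) (F : set_system T) :
  UltraFilter F -> UltraFilter (f @ F).
Proof.
move=> UF; have PF := ultra_proper.
split; first exact: fmap_proper_filter.
move=> G PG sFG; apply/seteqP; split=> // B GB.
have [//|nB] := in_ultra_setVsetC (f @^-1` B) UF.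
have [z []] := filter_ex (filterI GB (sFG (~` B) nB)).
by [].
Qed.

Lemma cvg_initial (S : choiceType) (T : topologicalType) (f : S -> T)
    (F : set_system S) (s : S) : Filter F ->
  f @ F --> f s -> F --> (s : initial_topology f).
Proof.
move=> FF fF B /= [_ [[C oC <-] Cs CB]].
by apply: filterS CB _; apply: fF; exact: open_nbhs_nbhs.
Qed.

Lemma cvg_prod_topology (I : Type) (T : I -> topologicalType)
    (F : set_system (prod_topology T)) (p : prod_topology T) : Filter F ->
  (forall i, (fun q : prod_topology T => q i) @ F --> p i) -> F --> p.
Proof. by move=> FF Fp; apply/cvg_sup => i; exact: cvg_initial. Qed.

Lemma proj_prod_topology_continuous (I : Type) (T : I -> topologicalType)
    (i : I) : continuous (fun q : prod_topology T => q i).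
Proof. exact: (@proj_continuous {classic I} T i). Qed.

(** The sets are traces of neighborhoods whose closures lie in the [G n]. An ultrafilter containing
    them converges in [K] by compactness, its limit lies in every [G n], hence in the range of [e],
    and the embedding pulls the convergence back. *)
Lemma cech_complete_nbhs_seq (T : topologicalType) (x : T) :
  cech_complete T ->
  exists W : nat -> set T, (forall n, nbhs x (W n)) /\
    forall F : set_system T, UltraFilter F -> (forall n, F (W n)) ->
    exists y : T, F --> y.
Proof.
move=> [_ [K [e [hK cK [_ ce oe] _ [G oG eG]]]]].
have Gx n : nbhs (e x) (G n).
  apply: open_nbhs_nbhs; split=> //.
  have : range e (e x) by exists x.
  by rewrite eG; apply.
have /choice[N NP] n : exists C, nbhs (e x) C /\ closure C `<=` G n.
  have [C xC CG] := compact_regular hK cK filterT (Gx n).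
  by exists C.
exists (fun n => e @^-1` N n); split=> [n|F UF FW].
  by apply: ce; have [] := NP n.
have UeF := ultra_fmap e UF.
have PF := @ultra_proper _ F UF.
have := cK; rewrite compact_ultra => /(_ _ UeF filterT)[z [_ /= Fz]].
have [y _ yz] : range e z.
  rewrite eG => n _; have [_] := NP n; apply=> B /Fz.
  rewrite nbhs_filterE => FB.
  have [t []] := filter_ex (filterI (FW n) FB : F (e @^-1` (N n `&` B))).
  by exists (e t).
exists y => B; rewrite nbhsE => -[C [/oe [V oV VC] Cy] CB].
have /Fz FV : nbhs z V.
  by apply: open_nbhs_nbhs; split=> //; rewrite -yz; move: Cy; rewrite -VC.
rewrite nbhs_filterE; apply: filterS (FV : F (e @^-1` V)) => t Vt.
by apply: CB; rewrite -VC.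
Qed.

(** Ordered by inclusion of [s], the modified points form a net converging to [q] in each
    coordinate; [F] is the filter of its tails. *)
Lemma dense_finite_support (I : Type) (T : I -> topologicalType)
    (p q : prod_topology T) (B : set (prod_topology T)) : nbhs q B ->
  exists s : seq {classic I}, B (fun i => if i \in s then q i else p i).
Proof.
pose qs (s : seq {classic I}) : prod_topology T :=
  fun i => if i \in s then q i else p i.
pose F : set_system (prod_topology T) :=
  [set B | exists s : seq {classic I},
    forall s' : seq {classic I}, {subset s <= s'} -> B (qs s')].
have FF : Filter F.
  split=> [|B1 B2 [s1 s1B] [s2 s2B]|B1 B2 B12 [s sB]].
  - by exists [::].
  - exists (s1 ++ s2) => s s12; split.
      by apply: s1B => i s1i; apply: s12; rewrite mem_cat s1i.
    by apply: s2B => i s2i; apply: s12; rewrite mem_cat s2i orbT.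
  - by exists s => s' /sB /B12.
have Fq : F --> q.
  apply: cvg_prod_topology => i C /nbhs_singleton Cq.
  by exists [:: i : {classic I}] => s /(_ i); rewrite inE eqxx /= /qs => ->.
by move=> /Fq [s /(_ s) sB]; exists s; exact: sB.
Qed.

Lemma product_of_cech_complete_nearly_qD (X : topologicalType) :
  product_of_cech_complete X -> nearly_qD_space X.
Proof.
move=> [I [T [cT [h [g [hK gK ch cg]]]]]].
have [[x0 _]|noX] := pselect (exists x0 : X, True); last first.
  exists set0; last by move=> x; exfalso; apply: noX; exists x.
  by move=> O [x _]; exfalso; apply: noX; exists x.
pose p := h x0.
pose supp_in (x : X) (s : seq {classic I}) :=
  forall i : I, (i : {classic I}) \notin s -> h x i = p i.
exists [set x | exists s, supp_in x s].
  move=> O [x Ox] oO.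
  have : nbhs (h x) (g @^-1` O).
    by apply: cg; rewrite hK; exact: open_nbhs_nbhs.
  move=> /(dense_finite_support p)[s Os].
  exists (g (fun i => if (i : {classic I}) \in s then h x i else p i)).
  by split=> //; exists s => i /negbTE si; rewrite gK si.
move=> x.
pose WP i := cid (cech_complete_nbhs_seq (h x i) (cT i)).
pose W i := projT1 (WP i).
have xW i : forall n, nbhs (h x i) (W i n) := (projT2 (WP i)).1.
have Wcvg i := (projT2 (WP i)).2.
(* After [n] points, the first [n] sets [W i m] are imposed in each coordinate where some earlier
   point differs from [p]. Finite supports leave finitely many constraints. *)
exists (fun us => [set y | forall i k m, (k < size us)%N -> (m < size us)%N ->
  h (nth x us k) i <> p i -> W i m (h y i)]) => u /=; split=> [n un|uleg].
  have /choice[s sP] k : exists s, (k <= n)%N -> supp_in (u k) s.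
    have [kn|] := leqP k n; last by exists [::].
    by have [_ [s us]] := un k kn; exists s.
  have xn : nbhs x [set y | forall k, k \in iota 0 n.+1 ->
      forall i, i \in s k -> forall m, m \in iota 0 n.+1 -> W i m (h y i)].
    apply: filter_forall_seq => k _; apply: filter_forall_seq => i _.
    apply: filter_forall_seq => m _.
    exact: (ch x _ (@proj_prod_topology_continuous _ T i (h x) _ (xW i m))).
  apply: filterS xn => y yP i k m; rewrite size_map size_iota => kn mn.
  rewrite (@nth_mkseq X _ u)// => up; apply: (yP k) => //; rewrite ?mem_iota//.
  by apply/negPn/negP => /(sP k kn)/up.
have [U [UU oU]] := ultraFilterLemma eventually_filter.
have PU := @ultra_proper _ U UU.
have Ui i : exists y : T i, (fun n => h (u n) i) @ U --> y.
  have [[k up]|up] := pselect (exists k, h (u k) i <> p i); last first.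
    exists (p i); rewrite (_ : (fun n => _) = fun=> p i); first exact: cvg_cst.
    by apply: funext => n; apply: contra_notP up => up; exists n.
  (* Once [k] and [m] are at most [n], the answer to [u n] imposes [W i m] on [u n.+1], hence the
     successor in the bound. *)
  apply: Wcvg; first exact: ultra_fmap.
  move=> m; apply: oU; exists (maxn k m).+1 => // n /= kmn.
  case: n kmn => // n; rewrite ltnS geq_max => /andP[kn mn].
  have [+ _] := uleg n.+1.
  rewrite mkseqS last_rcons => /(_ i k m).
  by rewrite size_map size_iota nth_mkseq//; apply.
pose y : prod_topology T := fun i => projT1 (cid (Ui i)).
have hy : (h \o u) @ U --> y.
  by apply: cvg_prod_topology => i; exact: (projT2 (cid (Ui i))).
exists (g y) => A B Au yB.
have UB : U (u @^-1` B).
  have UgB : U ((h \o u) @^-1` (g @^-1` B)) := hy _ (cg y _ yB).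
  by apply: filterS UgB => n; rewrite /= hK.
have [n [An Bn]] := filter_ex (filterI (oU _ Au) UB).
by exists (u n).
Qed.

(** * Bounded subsets of C_p(X) *)

Section Cp.
Variables (R : realType) (X : topologicalType).
Implicit Types (Y : set (Cp R X)) (h : X -> R).

Definition ev (y : Cp R X) (z : X) : R := (y : continuousType X R) z.

Lemma ev_continuous (y : Cp R X) : continuous (ev y).
Proof. exact: (@cts_fun _ _ (y : continuousType X R)). Qed.

Lemma continuous_ev (z : X) : continuous (ev^~ z).
Proof.
move=> y; apply: (@continuous_comp _ _ _
  (fun y : Cp R X => (y : continuousType X R) : {ptws X -> R}) (@^~ z)).
  exact: initial_continuous.
exact: proj_prod_topology_continuous.
Qed.

Lemma cvg_Cp (F : set_system (Cp R X)) (y : Cp R X) : Filter F ->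
  (forall z, ev^~ z @ F --> ev y z) -> F --> y.
Proof.
by move=> FF Fy; apply: cvg_initial; exact: cvg_prod_topology.
Qed.

(* [h] lies in the closure of [Y] in the product [X -> R]. *)
Definition ptws_adherent Y h :=
  forall (s : seq X) (e : R), 0 < e ->
  exists2 y, Y y & forall z, z \in s -> `|ev y z - h z| < e.

Lemma bounded_in_ev Y (z : X) : bounded_in R Y ->
  exists2 M : R, 0 < M & forall y, Y y -> `|ev y z| <= M.
Proof.
move=> /(_ _ (@continuous_ev z))/ex_strict_bound_gt0[M M0 YM].
by exists M => // y Yy; apply/ltW/YM; exists y.
Qed.

(** Some [u t] is within [e / 2] of [h] on [s], and some member of [Y] is within [e / 2] of [u t]
    there. *)
Lemma ptws_adherent_cvg Y h (T : Type) (F : set_system T) (u : T -> Cp R X) :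
  ProperFilter F -> F (u @^-1` (closure Y)) ->
  (forall z, (fun t => ev (u t) z) @ F --> h z) -> ptws_adherent Y h.
Proof.
move=> PF FY uh s e e0; have e20 : 0 < e / 2 by rewrite divr_gt0.
have Fs : F [set t | forall z, z \in s -> `|ev (u t) z - h z| < e / 2].
  apply: filter_forall_seq => z _.
  have /cvgrPdist_lt/(_ _ e20) := uh z.
  by apply: filterS => t; rewrite distrC.
have [t [clt tsh]] := filter_ex (filterI FY Fs).
have ts : nbhs (u t)
    [set y | forall z, z \in s -> `|ev y z - ev (u t) z| < e / 2].
  apply: filter_forall_seq => z _.
  have /cvgrPdist_lt/(_ _ e20) := @continuous_ev z (u t).
  by apply: filterS => y; rewrite distrC.
have [y [Yy yt]] := clt _ ts; exists y => // z zs.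
rewrite -(subrK (ev (u t) z) (ev y z)) -addrA (le_lt_trans (ler_normD _ _))//.
by rewrite (splitr e) ltrD// ?yt// tsh.
Qed.

(* Otherwise the inverse of [g |-> sup_i min (1/(i+1)) |g (c i) - h (c i)|]
   is continuous on [Cp R X] and unbounded on [Y]. *)
Lemma bounded_adherent_extends_seq Y h (c : nat -> X) : bounded_in R Y ->
  ptws_adherent Y h -> exists g : Cp R X, forall i, ev g (c i) = h (c i).
Proof.
move=> bY adY; apply: contrapT => nog.
pose t (g : Cp R X) i : R := Num.min i.+1%:R^-1 `|ev g (c i) - h (c i)|.
pose d g := sup (range (t g)).
have t0 g i : 0 <= t g i by rewrite le_min invr_ge0 ler0n normr_ge0.
have tub g : has_ubound (range (t g)).
  exists 1 => _ [i _ <-]; rewrite ge_min; apply/orP; left.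
  by rewrite invf_le1 ?ltr0n// ler1n.
have td g i : t g i <= d g by apply: ub_le_sup => //; exists i.
have dle g M : (forall i, t g i <= M) -> d g <= M.
  by move=> tM; apply: ge_sup; [exists (t g 0%N), 0%N|move=> _ [i _ <-]].
have d_gt0 g : 0 < d g.
  have /existsNP[i /eqP gi] : ~ forall i, ev g (c i) = h (c i).
    by move=> ?; apply: nog; exists g.
  apply: lt_le_trans (td g i).
  by rewrite lt_min invr_gt0 ltr0n normr_gt0 subr_eq0.
have tail (e : R) : 0 < e -> exists N, forall i, (N <= i)%N -> i.+1%:R^-1 < e.
  by move=> e0; have [N _ NP] := near_infty_natSinv_lt (PosNum e0); exists N.
have cd : continuous d.
  move=> g; apply/(@cvgrPdist_le _ _ _ (nbhs g) (nbhs_filter g)) => e e0.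
  have [N NP] := tail e e0.
  have : nbhs g [set g' | forall i, i \in iota 0 N ->
      `|ev g (c i) - ev g' (c i)| < e].
    apply: (@filter_forall_seq _ (nbhs g)) => i _.
    by have /cvgrPdist_lt/(_ _ e0) := @continuous_ev (c i) g.
  apply: filterS => g' gg'.
  (* From [N] on both terms lie between 0 and [e]; the earlier ones depend on finitely many
     evaluations. *)
  have tt i : `|t g i - t g' i| <= e.
    have [iN|Ni] := ltnP i N; last first.
      have := NP i Ni; have := t0 g i; have := t0 g' i.
      have : t g i <= i.+1%:R^-1 by rewrite ge_min lexx.
      have : t g' i <= i.+1%:R^-1 by rewrite ge_min lexx.
      move: (i.+1%:R^-1) (t g i) (t g' i) => r a b.
      by rewrite ler_norml => *; apply/andP; split; lra.
    have := gg' i; rewrite mem_iota => /(_ iN) /ltW.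
    move: (ler_dist_dist (ev g (c i) - h (c i)) (ev g' (c i) - h (c i))).
    rewrite (_ : ev g (c i) - h (c i) - (ev g' (c i) - h (c i)) =
      ev g (c i) - ev g' (c i)); last by ring.
    move=> /le_trans H /H; rewrite /t.
    set a := `|ev g (c i) - h (c i)|; set b := `|ev g' (c i) - h (c i)|.
    move: (i.+1%:R^-1) => r; rewrite !ler_norml /Order.min => /andP[? ?].
    do 2 case: ifPn; rewrite -?leNgt => ? ?; apply/andP; split; lra.
  have gle : d g <= d g' + e.
    apply: dle => i; have := tt i; have := td g' i.
    by rewrite ler_norml => ? /andP[]; lra.
  have g'le : d g' <= d g + e.
    apply: dle => i; have := tt i; have := td g i.
    by rewrite ler_norml => ? /andP[]; lra.
  by rewrite ler_norml; apply/andP; split; lra.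
have [|M M0 YM] := @ex_strict_bound_gt0 _ _ _ id
    (globally ((fun g => (d g)^-1) @` Y)).
  apply: bY => g; apply: (@cvgV _ _ (nbhs g) _ d (d g)).
    by rewrite gt_eqF.
  exact: cd.
have Mi : 0 < M^-1 by rewrite invr_gt0.
have [N NP] := tail _ Mi.
(* Terms from [N] on are below [M^-1] anyway, so closeness at the first [N] points gives
   [d y <= M^-1], against the bound [M]. *)
have [y Yy yh] := adY [seq c i | i <- iota 0 N] _ Mi.
have : d y <= M^-1.
  apply: dle => i; have [iN|Ni] := ltnP i N.
    by rewrite ge_min (ltW (yh _ _)) ?orbT// map_f// mem_iota.
  by rewrite ge_min (ltW (NP _ Ni)).
apply/negP; rewrite -ltNge -(invrK (d y)) ltf_pV2 ?posrE ?invr_gt0//.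
have /= := YM (d y)^-1; rewrite normfV gtr0_norm//; apply.
by exists y.
Qed.

Lemma continuous_eq_closure (g g' : X -> R) (A : set X) :
  continuous g -> continuous g' -> {in A, g =1 g'} ->
  {in closure A, g =1 g'}.
Proof.
move=> cg cg' gg' z; rewrite inE => clz; apply/eqP; rewrite -subr_eq0.
apply/eqP; have : closed ((fun x => g x - g' x) @^-1` [set 0]).
  apply: preimage_closed; last exact: closed_eq.
  by move=> x _; apply: continuousB; [exact: cg|exact: cg'].
apply; apply: closureS clz => x Ax /=.
by rewrite gg' ?inE// subrr.
Qed.

(** For [z] in the closure, the sequence with [z] prepended yields [g'] with the value [h z] at [z];
    [g] and [g'] agree along [c], hence at [z]. *)
Lemma bounded_adherent_extends Y h (c : nat -> X) : bounded_in R Y ->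
  ptws_adherent Y h ->
  exists g : Cp R X, forall z, closure (range c) z -> ev g z = h z.
Proof.
move=> bY adY; have [g gc] := bounded_adherent_extends_seq c bY adY.
exists g => z clz.
have [g' g'c] := bounded_adherent_extends_seq
  (fun n => if n is m.+1 then c m else z) bY adY.
rewrite -(g'c 0%N); apply: (@continuous_eq_closure _ _ (range c)).
- exact: ev_continuous.
- exact: ev_continuous.
- by move=> x; rewrite inE => -[i _ <-]; rewrite gc (g'c i.+1).
- by rewrite inE.
Qed.

End Cp.

(** * Pointwise limits of bounded sets over $w_s$-$q_f$-spaces *)

Lemma separable_subset_closure_range (X : topologicalType) (S : set X)
    (x : X) : (exists2 L, separable_set L & S `<=` L) ->
  exists c : nat -> X, S `<=` closure (range c).
Proof.
move=> [L [C [/countable_injP[i iinj] _ LC]] SL].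
(* Indices coding no point of [C] take the value [x], which only enlarges the closure and also
   covers an empty [C]. *)
exists (fun n => xget x [set z | C z /\ i z = n]).
apply: subset_trans SL (subset_trans LC _); apply: closureS => z Cz.
exists (i z) => //.
have /xgetPex : exists z', [set z' | C z' /\ i z' = i z] z' by exists z.
by move=> /(_ x) [Cz' /iinj]; rewrite !inE; apply.
Qed.

Lemma not_closure_image_far (R : realType) (X : Type) (f : X -> R) (A : set X)
    (r : R) : ~ closure (f @` A) r ->
  exists2 e, 0 < e & forall a, A a -> e <= `|f a - r|.
Proof.
rewrite /closure /= => /existsNP [B] /not_implyP [+ nB].
move=> /nbhs_ballP [e /= e0 eB]; exists e => // a Aa.
rewrite leNgt; apply/negP => far; apply: nB; exists (f a).
by split; [exists a | apply: eB; rewrite /ball /= distrC].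
Qed.

Lemma functionally_separated_by_distance (R : realType) (X : topologicalType)
    (g : X -> R) (r e : R) (S A : set X) : continuous g -> 0 < e ->
  (forall s, S s -> g s = r) -> (forall a, A a -> e <= `|g a - r|) ->
  functionally_separated R S A.
Proof.
move=> cg e0 Sr Ae.
exists (fun z => Num.min (`|g z - r| / e) 1); split.
- move=> z; apply: (@continuous_comp _ _ _ g
    (fun y => Num.min (`|y - r| / e) 1)).
    exact: cg.
  apply: continuous_min; last exact: cvg_cst.
  apply: cvgMl; apply: cvg_norm; apply: cvgB; [exact: cvg_id|exact: cvg_cst].
- move=> _ [z _ <-]; rewrite /= in_itv /= le_min ler01 ge_min lexx orbT !andbT.
  by rewrite divr_ge0// ltW.
- by move=> _ [s /Sr sr <-]; rewrite /= sr subrr normr0 mul0r min_l.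
- move=> _ [a /Ae ae <-]; rewrite /= min_r//.
  by rewrite ler_pdivlMr// mul1r.
Qed.

Section ws_qf.
Variables (R : realType) (X : topologicalType).

(** At each point the bound on [Y] passes to its closure, so the values stay in a compact
    segment. *)
Lemma bounded_ultra_cvg (Y : set (Cp R X)) (T : Type) (U : set_system T)
    (u : T -> Cp R X) : UltraFilter U -> bounded_in R Y ->
  U (u @^-1` closure Y) ->
  exists h : X -> R, forall z, (fun t => ev (u t) z) @ U --> h z.
Proof.
move=> UU bY UY.
suff /choice[h hP] z : exists r : R, (fun t => ev (u t) z) @ U --> r.
  by exists h.
have PU := @ultra_proper _ U UU.
have [M M0 YM] := bounded_in_ev z bY.
have clYM y : closure Y y -> `[- M, M]%classic (ev y z).
  have clE : closed ((ev (X := X))^~ z @^-1` `[- M, M]%classic).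
    apply: preimage_closed; last exact: itv_closed.
    by move=> y' _; exact: continuous_ev.
  move=> Yy; apply: clE; apply: closureS Yy => y' /YM.
  by rewrite /= in_itv /= ler_norml.
have UM : U (fun t => `[- M, M]%classic (ev (u t) z)).
  by apply: filterS UY => t /clYM.
have := @segment_compact R (- M) M; rewrite compact_ultra.
move=> /(_ _ (ultra_fmap (fun t => ev (u t) z) UU) UM)[r [_ Ur]].
by exists r.
Qed.

Lemma bounded_adherent_continuous (Y : set (Cp R X)) (f : X -> R) :
  ws_qf_space R X -> bounded_in R Y -> ptws_adherent Y f -> continuous f.
Proof.
move=> qX bY adf; apply: contrapT => /qX [A [x [_ _ fx]]].
have [e e0 Ae] := not_closure_image_far fx; apply.
have /choice[cS cSP] (S : set X) : exists c : nat -> X,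
    (exists2 L, separable_set L & S `<=` L) -> S `<=` closure (range c).
  have [SL|] := pselect (exists2 L, separable_set L & S `<=` L).
    by have [c cP] := separable_subset_closure_range x SL; exists c.
  by move=> ?; exists (fun=> x).
(* Every point of the dense sequence of a move of [alpha] eventually enters
   [pts], so [f] is the limit of the [phi]'s at these points. *)
pose pts (Ss : seq (set X)) := x ::
  [seq cS (nth set0 Ss i) j | i <- iota 0 (size Ss), j <- iota 0 (size Ss)].
have /choice[phi phiP] (Ss : seq (set X)) : exists y, Y y /\
    forall z, z \in pts Ss -> `|ev y z - f z| < (size Ss).+1%:R^-1.
  have [|y Yy yP] := adf (pts Ss) (size Ss).+1%:R^-1.
    by rewrite invr_gt0 ltr0n.
  by exists y.
(* Each function chosen so far, including the current one, is constrained again in every later move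
   with tolerance tending to 0; on the intersection of all moves it therefore equals its value at
   [x]. *)
exists (fun Ss => [set z | forall k, k \in iota 0 (size Ss).+1 ->
  `|ev (phi (take k Ss)) z - ev (phi (take k Ss)) x| < (size Ss).+1%:R^-1]).
move=> S /=; split=> [n _|Sleg].
  apply: filter_forall_seq => k _.
  have n0 : (0 : R) < (size (mkseq S n)).+1%:R^-1 by rewrite invr_gt0 ltr0n.
  have /cvgrPdist_lt/(_ _ n0) :=
    @ev_continuous _ _ (phi (take k (mkseq S n))) x.
  by apply: filterS => z; rewrite distrC.
move=> [S' [S'V S'L nsep]].
pose u n := phi (mkseq S n).
have uS' n s : S' s -> ev (u n) s = ev (u n) x.
  move=> S's; apply/eqP; rewrite -subr_eq0 -normr_le0.
  apply/ler_addgt0Pr => d d0; rewrite add0r.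
  have [N _ NP] := near_infty_natSinv_lt (PosNum d0).
  pose m := maxn n N; have nm : (n <= m)%N := leq_maxl n N.
  have nSm : n \in iota 0 (size (mkseq S m)).+1.
    by rewrite size_mkseq mem_iota ltnS.
  have := S'V s S's m I n nSm.
  rewrite size_mkseq -map_take take_iota (minn_idPl nm) => /ltW/le_trans; apply.
  by apply/ltW/NP; rewrite /= leq_maxr.
have [U [UU oU]] := ultraFilterLemma eventually_filter.
have PU := @ultra_proper _ U UU.
have UY : U (u @^-1` closure Y).
  apply: filterS filterT => n _; apply: subset_closure.
  by have [] := phiP (mkseq S n).
have [h uh] := bounded_ultra_cvg UU bY UY.
have adh := ptws_adherent_cvg PU UY uh.
have hf z N : (forall n, (N <= n)%N -> z \in pts (mkseq S n)) -> h z = f z.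
  move=> zN; apply: (@cvg_unique R (@Rhausdorff R) _ _ _ _ (uh z)).
  apply/cvgrPdist_lt => d d0; apply: oU.
  have [M _ MP] := near_infty_natSinv_lt (PosNum d0).
  exists (maxn M N) => // n /=; rewrite geq_max => /andP[Mn Nn].
  have [_ /(_ z (zN n Nn))] := phiP (mkseq S n).
  by rewrite size_mkseq distrC => /lt_trans; apply; apply: MP.
have hx : h x = f x by apply: (hf x 0%N) => n _; rewrite inE eqxx.
have hS' s : S' s -> h s = f x.
  move=> S's; rewrite -hx.
  apply: (@cvg_unique R (@Rhausdorff R) _ _ _ _ (uh s)).
  rewrite (_ : (fun n => ev (u n) s) = fun n => ev (u n) x).
    exact: uh.
  by apply: funext => n; exact: uS'.
have hcS i j : h (cS (S i) j) = f (cS (S i) j).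
  apply: (hf _ (maxn i j).+1) => n; rewrite gtn_max => /andP[ni nj].
  rewrite inE; apply/orP; right; apply/allpairsP; exists (i, j) => /=.
  by rewrite !mem_iota size_mkseq nth_mkseq.
(* One sequence merges the dense sequences of all [S i] ([Some i]) and of [S'] ([None]), so that a
   single extension serves them all. *)
pose c n := if (unpickle n : option (option nat * nat)) is Some (k, j)
  then cS (if k is Some i then S i else S') j else x.
have cE k j : c (pickle (k, j)) = cS (if k is Some i then S i else S') j.
  by rewrite /c pickleK.
have [g gh] := bounded_adherent_extends c bY adh.
have [g' g'f] := bounded_adherent_extends c bY adf.
have rc (k : option nat) :
    range (cS (if k is Some i then S i else S')) `<=` range c.
  by move=> _ [j _ <-]; exists (pickle (k, j)); rewrite ?cE.
have clc (k : option nat) :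
    closure (range (cS (if k is Some i then S i else S')))
    `<=` closure (range c).
  exact/closureS/rc.
(* [f] and [h] agree on a dense sequence of [S i], hence their extensions
   agree on [S i]. *)
have gS i s : S i s -> ev g s = f s.
  have [SA SL] := Sleg i => Sis.
  have cls := cSP _ SL s Sis.
  rewrite -(g'f s (clc (Some i) _ cls)).
  apply: (@continuous_eq_closure _ _ _ _ (range (cS (S i)))).
  - exact: ev_continuous.
  - exact: ev_continuous.
  - move=> z; rewrite inE => -[j _ <-].
    have clz : closure (range c) (cS (S i) j).
      by apply/subset_closure/(rc (Some i)); exists j.
    by rewrite gh// g'f.
  - by rewrite inE.
(* [ev g] is constantly [f x] on [S'] and equals [f] on the moves of alpha, which lie in [A], so it
   stays at distance at least [e] from [f x] there. *)
apply: nsep; apply: (@functionally_separated_by_distance _ _ (ev g) (f x) e).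
- exact: ev_continuous.
- exact: e0.
- move=> s S's; rewrite gh ?hS'//.
  by apply: (clc None); apply: cSP.
- move=> a [i _ Sia]; rewrite (gS i)//; apply: Ae.
  by have [+ _] := Sleg i; apply.
Qed.

(** An ultrafilter on the closure converges pointwise, and continuity of the limit places it in
    [Cp R X]. *)
Lemma ws_qf_mu_sharp_b_complete : ws_qf_space R X -> mu_sharp_b_complete R X.
Proof.
move=> qX Y bY; rewrite compact_ultra => F UF FY.
have PF := @ultra_proper _ F UF.
have [h Fh] := bounded_ultra_cvg UF bY (FY : F (id @^-1` closure Y)).
have adh := ptws_adherent_cvg PF (FY : F (id @^-1` closure Y)) Fh.
have ch := bounded_adherent_continuous qX bY adh.
pose y : Cp R X := HB.pack_for (continuousType X R) h
  (@isContinuous.Build X R h ch).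
have Fy : F --> y by exact: cvg_Cp.
exists y; split=> //; apply: closed_closure => B /Fy.
rewrite nbhs_filterE => FB; have [z YBz] := filter_ex (filterI FY FB).
by exists z.
Qed.

End ws_qf.

Theorem proposition25 (R : realType) (X : topologicalType)
    (tychX : tychonoff_space X) :
  (product_of_cech_complete X -> nearly_qD_space X) /\
  (nearly_qD_space X -> W1_qf_space R X) /\
  (W1_qf_space R X -> ws_qf_space R X) /\
  (ws_qf_space R X -> mu_sharp_b_complete R X) /\
  (product_of_cech_complete X -> mu_sharp_b_complete R X).
Proof.
have H54 := @product_of_cech_complete_nearly_qD X.
have H43 := @nearly_qD_W1_qf_space R X tychX.2.
have H32 := @W1_ws_qf_space R X.
have H21 := @ws_qf_mu_sharp_b_complete R X.
do 4 (split; first by []).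
by move=> /H54/H43/H32/H21.
Qed.
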